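(* Let $\eta$ be any positive equivalence relation. The following are equivalent: (1) there is an $\eta$-family that is explanatorily learnable but not monotonically behaviourally correctly learnable; (2) there is an $\eta$-family that is class-preservingly weakly monotonically explanatorily learnable but not monotonically behaviourally correctly learnable; (3) there is an $\eta$-infinite r.e. set that is different from $\mathbb N$.
   Context: A positive equivalence relation is an equivalence relation $\eta$ on $\mathbb{N}$ that is recursively enumerable (as a set of pairs) and has infinitely many equivalence classes. A set is $\eta$-closed if it is a union of $\eta$-classes and $\eta$-infinite if it is a union of infinitely many $\eta$-classes. An $\eta$-family is an infinite family of $\eta$-closed sets possessing a uniformly r.e. one-one numbering $B_0,B_1,\dots$ (i.e. $\{\langle k,x\rangle:x\in B_k\}$ is r.e. and $B_i\neq B_j$ for $i\ne j$). $W_0,W_1,\dots$ is a fixed acceptable numbering of the r.e. sets. A text for $L$ is a total $T:\mathbb N\to\mathbb N\cup\{\#\}$ whose range minus $\{\#\}$ is $L$; $T[n]$ is its initial segment of length $n$, $\mathrm{cnt}(\sigma)$ the set of numbers in $\sigma$ and $\mathrm{cnt}(T)$ the range of $T$ minus $\{\#\}$. A learner is a recursive function $M$ from finite sequences over $\mathbb N\cup\{\#\}$ to $\mathbb N\cup\{?\}$. Outputs $e$ are interpreted as hypotheses $H_e$: by default $H_e$ is the $\eta$-closure of $W_e$; for class-preserving learning of $\mathcal C$, $H_0,H_1,\dots$ is some uniformly r.e. hypothesis space with $\{H_i:i\in\mathbb N\}=\mathcal C$. $M$ explanatorily learns $\mathcal C$ if on every text $T$ for every $L\in\mathcal C$ it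 outputs from some point on a single index $e$ with $H_e=L$; behaviourally correctly learns $\mathcal C$ if on every such text $H_{M(T[n])}=L$ for almost all $n$. $M$ is monotonic if for every text $T$ for a member of $\mathcal C$ and all $n,k$: $H_{M(T[n])}\cap\mathrm{cnt}(T)\subseteq H_{M(T[n+k])}\cap\mathrm{cnt}(T)$. $M$ is weakly monotonic if for all texts $T$ and all $n,k$: $\mathrm{cnt}(T[n+k])\subseteq H_{M(T[n])}$ implies $H_{M(T[n])}\subseteq H_{M(T[n+k])}$. *)

(* Defs.v *)
From mathcomp Require Import all_boot.
From mathcomp Require Import boolp classical_sets functions cardinality.

Set Implicit Arguments.
Unset Strict Implicit.
Unset Printing Implicit Defensive.

Local Open Scope classical_set_scope.

(* The total recursive functions, following Kleene and Shoenfield: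
   minimisation is only applied to regular functions, i.e. when a zero exists
   for every argument, so no partial functions are needed. *)
Inductive recursive : forall n, (n.-tuple nat -> nat) -> Prop :=
| rec_zero n : recursive (fun _ : n.-tuple nat => 0)
| rec_succ : recursive (fun v : 1.-tuple nat => (thead v).+1)
| rec_proj n (i : 'I_n) : recursive (fun v : n.-tuple nat => tnth v i)
| rec_comp m n (f : m.-tuple nat -> nat) (g : 'I_m -> n.-tuple nat -> nat) :
    recursive f -> (forall i, recursive (g i)) ->
    recursive (fun v : n.-tuple nat => f [tuple g i v | i < m])
| rec_prim n (f : n.-tuple nat -> nat) (g : n.+2.-tuple nat -> nat) :
    recursive f -> recursive g ->
    recursive (fun v : n.+1.-tuple nat =>
      nat_rect (fun _ => nat) (f [tuple of behead v])
        (fun k r => g [tuple of k :: r :: behead v]) (thead v))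
| rec_min n (f : n.+1.-tuple nat -> nat)
    (regular : forall v : n.-tuple nat, exists y, f [tuple of y :: v] == 0) :
    recursive f ->
    recursive (fun v : n.-tuple nat => ex_minn (regular v)).

Definition recursive1 (f : nat -> nat) : Prop :=
  recursive (fun v : 1.-tuple nat => f (thead v)).

(* An r.e. set of n-tuples is a projection of a recursive (n+1)-ary relation,
   the latter being given as the zero set of a recursive function. *)
Definition re n (A : set (n.-tuple nat)) : Prop :=
  exists2 f : n.+1.-tuple nat -> nat, recursive f &
    forall v, A v <-> exists s, f [tuple of s :: v] = 0.

Definition re_set (A : set nat) : Prop :=
  re [set v : 1.-tuple nat | A (thead v)].

Definition re_rel (R : nat -> nat -> Prop) : Prop :=
  re [set v : 2.-tuple nat | R (tnth v ord0) (tnth v ord_max)].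

Definition uniformly_re (V : nat -> set nat) : Prop :=
  re_rel (fun k x => V k x).

(* Taking V constant shows that such a W lists every r.e. set. *)
Definition acceptable (W : nat -> set nat) : Prop :=
  uniformly_re W /\
  forall V, uniformly_re V ->
    exists2 f, recursive1 f & forall i, V i = W (f i).

(* For a relation [eta : nat -> nat -> Prop], the set [eta x] is the class
   of x, so that [range eta] is the set of all classes. *)
Definition positive_equivalence (eta : nat -> nat -> Prop) : Prop :=
  [/\ RelationClasses.Equivalence eta, re_rel eta
    & infinite_set (range (eta : nat -> set nat))].

Definition eta_closed (eta : nat -> nat -> Prop) (A : set nat) : Prop :=
  exists2 K : set (set nat), K `<=` range (eta : nat -> set nat) &
    A = \bigcup_(c in K) c.

Definition eta_infinite (eta : nat -> nat -> Prop) (A : set nat) : Prop :=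
  exists K : set (set nat),
    [/\ K `<=` range (eta : nat -> set nat), infinite_set K
      & A = \bigcup_(c in K) c].

Definition eta_closure (eta : nat -> nat -> Prop) (A : set nat) : set nat :=
  \bigcup_(x in A) (eta x : set nat).

Definition eta_family (eta : nat -> nat -> Prop) (C : set (set nat)) : Prop :=
  [/\ infinite_set C, (forall A, C A -> eta_closed eta A)
    & exists B : nat -> set nat,
        [/\ uniformly_re B, injective B & range B = C]].

(* In data, [None] stands for the pause symbol #. *)
Definition text := nat -> option nat.

Definition initial_segment (T : text) (n : nat) : seq (option nat) := mkseq T n.

Definition cnt_seq (s : seq (option nat)) : set nat := [set x | Some x \in s].

Definition cnt (T : text) : set nat := [set x | exists n, T n = Some x].

Definition text_for (T : text) (L : set nat) : Prop := cnt T = L.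

(* As an output, [None] stands for the abstention symbol ?. *)
Definition learner_fun := seq (option nat) -> option nat.

Definition onat_code (o : option nat) : nat := oapp succn 0 o.

Definition seq_code (s : seq (option nat)) : nat :=
  CodeSeq.code (map onat_code s).

Definition learner (M : learner_fun) : Prop :=
  exists2 f, recursive1 f & forall s, f (seq_code s) = onat_code (M s).

Section Criteria.
Variables (H : nat -> set nat) (C : set (set nat)) (M : learner_fun).

Definition Ex_learns : Prop :=
  forall L T, C L -> text_for T L ->
    exists2 e, H e = L &
      exists m, forall n, m <= n -> M (initial_segment T n) = Some e.

Definition BC_learns : Prop :=
  forall L T, C L -> text_for T L ->
    exists m, forall n, m <= n ->
      exists2 e, M (initial_segment T n) = Some e & H e = L.

(* Monotonicity conditions compare conjectures, hence only apply to stages at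
   which the learner does not abstain. *)
Definition monotonic : Prop :=
  forall L T, C L -> text_for T L ->
    forall n k i j,
      M (initial_segment T n) = Some i ->
      M (initial_segment T (n + k)) = Some j ->
      H i `&` cnt T `<=` H j `&` cnt T.

(* The text ranges over all texts, also those for sets outside C. *)
Definition weakly_monotonic : Prop :=
  forall (T : text) n k i j,
    M (initial_segment T n) = Some i ->
    M (initial_segment T (n + k)) = Some j ->
    cnt_seq (initial_segment T (n + k)) `<=` H i ->
    H i `<=` H j.

End Criteria.

Section Learnability.
Variables (W : nat -> set nat) (eta : nat -> nat -> Prop) (C : set (set nat)).

Definition default_hyp (e : nat) : set nat := eta_closure eta (W e).

Definition Ex_learnable : Prop :=
  exists2 M, learner M & Ex_learns default_hyp C M.

Definition monotonically_BC_learnable : Prop :=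
  exists M, [/\ learner M, BC_learns default_hyp C M
              & monotonic default_hyp C M].

Definition class_preserving_space (H : nat -> set nat) : Prop :=
  uniformly_re H /\ range H = C.

Definition class_preservingly_weakly_monotonically_Ex_learnable : Prop :=
  exists H M, [/\ class_preserving_space H, learner M, Ex_learns H C M
                & weakly_monotonic H M].

End Learnability.

(* Main.v *)
(* If N is the only eta-infinite r.e. set, every member of an eta-family is
   N or a finite union of classes, and conjecturing the closure of the data is
   monotonic; should N be in the family, it has a finite telltale D (locking
   argument), and one switches to N once D has appeared.  Conversely, let A be
   an eta-infinite r.e. set with enumeration a_0, a_1, ... and let a lie outside
   A.  The family consisting of A and of the sets [a] u [a_0] u ... u [a_(k-1)]
   is learnt by conjecturing A until a appears, and then the set given by the
   least k with a_k not yet seen.  A learner that has conjectured A on part of a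
   text for A can be led to conjecture one of the other sets, thereby giving up
   an element of A which some larger set of the family contains: it is not
   monotonic. *)
Require Import Defs.
From mathcomp Require Import all_boot.
From mathcomp Require Import boolp classical_sets functions cardinality.

Set Implicit Arguments.
Unset Strict Implicit.
Unset Printing Implicit Defensive.

Local Open Scope classical_set_scope.

(** * Recursive functions of sequences *)

(* Functions of n variables are represented on all of [seq nat]; only the values
   on sequences of length n matter, so variables are read off with [nth 0]. *)
Definition Rec n (F : seq nat -> nat) :=
  recursive (fun v : n.-tuple nat => F v).

Definition RecL n m (X : seq nat -> seq nat) :=
  (forall v, size v = n -> size (X v) = m) /\
  forall i, Rec n (fun v => nth 0 (X v) i).

Lemma Rec_ext n F G :
  (forall v, size v = n -> F v = G v) -> Rec n F -> Rec n G.
Proof.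
move=> FG; rewrite /Rec; congr recursive.
by apply/funext => v; apply: FG; rewrite size_tuple.
Qed.

Lemma Rec_nth n i : Rec n (fun v => nth 0 v i).
Proof.
case: (ltnP i n) => [lt_in|le_ni].
  have := rec_proj (Ordinal lt_in); congr recursive.
  by apply/funext => v; rewrite (tnth_nth 0).
have := rec_zero n; congr recursive.
by apply/funext => v; rewrite nth_default // size_tuple.
Qed.

Lemma Rec_subst n m F X : Rec m F -> RecL n m X -> Rec n (fun v => F (X v)).
Proof.
move=> recF [szX recX].
have := rec_comp recF (fun i : 'I_m => recX i); congr recursive.
apply/funext => v; congr F; apply: (@eq_from_nth _ 0).
  by rewrite size_tuple szX ?size_tuple.
move=> i; rewrite size_tuple => lt_im.
by rewrite -[i]/(val (Ordinal lt_im)) -tnth_nth tnth_mktuple.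
Qed.

Lemma RecL_id n : RecL n n id.
Proof. by split=> // i; apply: Rec_nth. Qed.

Lemma RecL_nil n : RecL n 0 (fun=> [::]).
Proof.
by split=> // i; apply: Rec_ext (rec_zero n) => v _; rewrite nth_nil.
Qed.

Lemma RecL_cons n m f X :
  Rec n f -> RecL n m X -> RecL n m.+1 (fun v => f v :: X v).
Proof.
by move=> recf [szX recX]; split=> [v /szX /= ->//|[|i]] //=; apply: recX.
Qed.

Lemma RecL_behead n m X :
  RecL n m.+1 X -> RecL n m (fun v => behead (X v)).
Proof.
move=> [szX recX]; split=> [v /szX|i]; first by rewrite size_behead => ->.
by apply: Rec_ext (recX i.+1) => v _; rewrite nth_behead.
Qed.

Lemma Rec_var n m X i : RecL n m X -> Rec n (fun v => nth 0 (X v) i).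
Proof. by case. Qed.

(** [rec_prim] recurses on the first variable and drops it from the parameters; substituting
    [N v :: v] allows any recursive bound and keeps all of [v] as parameters. *)
Lemma Rec_prim n F g N :
    Rec n F -> Rec n N ->
    Rec n.+2 (fun w => g (nth 0 w 0) (nth 0 w 1) (behead (behead w))) ->
  Rec n (fun v => nat_rect (fun=> nat) (F v) (fun k r => g k r v) (N v)).
Proof.
move=> recF recN recg.
have recP := rec_prim recF recg.
have recW : Rec n.+1 (fun w => nat_rect (fun=> nat) (F (behead w))
    (fun k r => g k r (behead w)) (nth 0 w 0)).
  move: recP; congr recursive.
  by apply/funext => w; rewrite /thead (tnth_nth 0).
exact: Rec_subst recW (RecL_cons recN (RecL_id n)).
Qed.

Definition R1 (f : nat -> nat) := Rec 1 (fun v => f (nth 0 v 0)).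
Definition R2 (f : nat -> nat -> nat) :=
  Rec 2 (fun v => f (nth 0 v 0) (nth 0 v 1)).

Lemma R1_app f n F : R1 f -> Rec n F -> Rec n (fun v => f (F v)).
Proof.
by move=> recf recF; apply: Rec_subst recf (RecL_cons recF (RecL_nil n)).
Qed.

Lemma R2_app f n F G :
  R2 f -> Rec n F -> Rec n G -> Rec n (fun v => f (F v) (G v)).
Proof.
move=> recf recF recG.
exact: Rec_subst recf (RecL_cons recF (RecL_cons recG (RecL_nil n))).
Qed.

Lemma R1P f : recursive1 f <-> R1 f.
Proof.
rewrite /recursive1 /R1 /Rec; split; congr recursive;
  by apply/funext => v; rewrite /thead (tnth_nth 0).
Qed.

Lemma Rec_succ n F : Rec n F -> Rec n (fun v => (F v).+1).
Proof. by apply: (@R1_app succn); apply/R1P; apply: rec_succ. Qed.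

Lemma Rec_const n c : Rec n (fun=> c).
Proof. by elim: c => [|c]; [apply: rec_zero | apply: Rec_succ]. Qed.

(** Reduces recursiveness of a function to its two recursion equations, the form in which most of
    the arithmetic below is obtained. *)
Lemma Rec_loop n F G g N :
    Rec n F -> Rec n N ->
    Rec n.+2 (fun w => g (nth 0 w 0) (nth 0 w 1) (behead (behead w))) ->
    (forall v, G 0 v = F v) -> (forall k v, G k.+1 v = g k (G k v) v) ->
  Rec n (fun v => G (N v) v).
Proof.
move=> recF recN recg G0 GS; apply: Rec_ext (Rec_prim recF recN recg) => v _.
by elim: (N v) => [|k /= ->].
Qed.

Lemma RecL_drop1 n : RecL n.+1 n behead.
Proof. exact: RecL_behead (RecL_id n.+1). Qed.

Lemma Rec_lift n F : Rec n F -> Rec n.+1 (fun w => F (behead w)).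
Proof. by move/Rec_subst; apply; apply: RecL_drop1. Qed.

Lemma Rec_lift2 n F : Rec n F -> Rec n.+2 (fun w => F (behead (behead w))).
Proof.
by move/Rec_subst; apply; do 2!apply: RecL_behead; apply: RecL_id.
Qed.

(** * Arithmetic, Boolean and search operations *)

Lemma Rec_add n F G : Rec n F -> Rec n G -> Rec n (fun v => F v + G v).
Proof.
move=> recF recG.
apply: (Rec_loop (G := fun k v => F v + k) (g := fun k r v => r.+1) recF recG).
- by apply: Rec_succ; apply: Rec_nth.
- by move=> v; rewrite addn0.
- by move=> k v; rewrite addnS.
Qed.

Lemma Rec_pred n F : Rec n F -> Rec n (fun v => (F v).-1).
Proof.
move=> recF; apply: (Rec_loop (G := fun k v => k.-1) (g := fun k r v => k)
  (Rec_const n 0) recF) => //.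
exact: Rec_nth.
Qed.

Lemma Rec_sub n F G : Rec n F -> Rec n G -> Rec n (fun v => F v - G v).
Proof.
move=> recF recG.
apply: (Rec_loop (G := fun k v => F v - k) (g := fun k r v => r.-1) recF recG).
- by apply: Rec_pred; apply: Rec_nth.
- by move=> v; rewrite subn0.
- by move=> k v; rewrite subnS.
Qed.

Lemma Rec_mul n F G : Rec n F -> Rec n G -> Rec n (fun v => F v * G v).
Proof.
move=> recF recG; apply: (Rec_loop (G := fun k v => F v * k)
  (g := fun k r v => F v + r) (Rec_const n 0) recG).
- by apply: Rec_add (Rec_nth _ _); apply: Rec_lift2.
- by move=> v; rewrite muln0.
- by move=> k v; rewrite mulnS.
Qed.

Lemma Rec_sum n N F :
    Rec n N -> Rec n.+1 (fun w => F (nth 0 w 0) (behead w)) ->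
  Rec n (fun v => \sum_(i < N v) F i v).
Proof.
move=> recN recF; apply: (Rec_loop (G := fun k v => \sum_(i < k) F i v)
  (g := fun k r v => r + F k v) (Rec_const n 0) recN).
- apply: Rec_add; first exact: Rec_nth.
  have RL2 : RecL n.+2 n (fun w => behead (behead w)).
    by do 2!apply: RecL_behead; apply: RecL_id.
  exact: Rec_subst recF (RecL_cons (Rec_nth _ 0) RL2).
- by move=> v; rewrite big_ord0.
- by move=> k v; rewrite big_ord_recr.
Qed.

Lemma Rec_iter n f N F :
  R1 f -> Rec n N -> Rec n F -> Rec n (fun v => iter (N v) f (F v)).
Proof.
move=> recf recN recF; apply: (Rec_loop (G := fun k v => iter k f (F v))
  (g := fun k r v => f r) recF recN) => //.
exact: R1_app recf (Rec_nth _ _).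
Qed.

Lemma Rec_leq n F G : Rec n F -> Rec n G -> Rec n (fun v => F v <= G v).
Proof.
move=> recF recG.
apply: Rec_ext (Rec_sub (Rec_const n 1) (Rec_sub recF recG)) => v _.
by rewrite /leq; case: (F v - G v).
Qed.

Lemma Rec_eq n F G : Rec n F -> Rec n G -> Rec n (fun v => F v == G v).
Proof.
move=> recF recG.
apply: Rec_ext (Rec_mul (Rec_leq recF recG) (Rec_leq recG recF)) => v _.
by rewrite mulnb -eqn_leq.
Qed.

Lemma Rec_neg n (b : seq nat -> bool) : Rec n b -> Rec n (fun v => ~~ b v).
Proof.
move=> recb; apply: Rec_ext (Rec_sub (Rec_const n 1) recb) => v _.
by case: (b v).
Qed.

Lemma Rec_and n (b c : seq nat -> bool) :
  Rec n b -> Rec n c -> Rec n (fun v => b v && c v).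
Proof.
by move=> recb recc; apply: Rec_ext (Rec_mul recb recc) => v _; rewrite mulnb.
Qed.

Lemma Rec_or n (b c : seq nat -> bool) :
  Rec n b -> Rec n c -> Rec n (fun v => b v || c v).
Proof.
move=> /Rec_neg recb /Rec_neg recc.
by apply: Rec_ext (Rec_neg (Rec_and recb recc)) => v _; rewrite negb_and !negbK.
Qed.

Lemma Rec_if n (b : seq nat -> bool) F G :
  Rec n b -> Rec n F -> Rec n G -> Rec n (fun v => if b v then F v else G v).
Proof.
move=> recb recF recG.
apply: Rec_ext (Rec_add (Rec_mul recb recF) (Rec_mul (Rec_neg recb) recG)).
by move=> v _; case: (b v); rewrite !(mul1n, mul0n, addn0).
Qed.

Lemma Rec_mu n (p : nat -> seq nat -> bool) (ex : forall v, exists y, p y v) :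
    Rec n.+1 (fun w => p (nth 0 w 0) (behead w)) ->
  Rec n (fun v => ex_minn (ex v)).
Proof.
move=> recp; pose F w : nat := ~~ p (nth 0 w 0) (behead w).
have regular (v : n.-tuple nat) : exists y, F (y :: v) == 0.
  by have [y py] := ex v; exists y; rewrite /F /= py.
have recF : Rec n.+1 F by apply: Rec_neg.
have := @rec_min n (fun v => F v) regular recF; congr recursive.
apply/funext => v; apply: eq_ex_minn => y.
by rewrite /F /= eqb0 negbK.
Qed.

Lemma Rec_odd n F : Rec n F -> Rec n (fun v => odd (F v)).
Proof.
move=> recF; apply: (Rec_loop (G := fun k v => nat_of_bool (odd k))
  (g := fun k r v => r == 0 :> nat) (Rec_const n 0) recF) => //.
  by apply: Rec_eq; [apply: Rec_nth | apply: Rec_const].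
by move=> k v /=; case: (odd k).
Qed.

Lemma Rec_half n F : Rec n F -> Rec n (fun v => (F v)./2).
Proof.
move=> recF; apply: (Rec_loop (G := fun k v => k./2)
  (g := fun k r v => odd k + r) (Rec_const n 0) recF) => //.
  by apply: Rec_add; [apply: Rec_odd|]; apply: Rec_nth.
by move=> k v; rewrite -uphalf_half.
Qed.

Ltac rec_var :=
  solve [ exact: Rec_const | exact: Rec_nth
        | apply: Rec_var; repeat apply: RecL_behead; exact: RecL_id ].

(** * Decoding of sequences *)

Lemma iter_half_expn n m j :
  j <= n -> iter j half (2 ^ n * m) = 2 ^ (n - j) * m.
Proof.
elim: j => [|j IHj] lt_jn; first by rewrite subn0.
rewrite iterS (IHj (ltnW lt_jn)) -(subnSK lt_jn) expnS -mulnA mul2n.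
by rewrite doubleK.
Qed.

(** The code of [n :: s] is [2 ^ n] times an odd number, so its head is the number of halvings until
    an odd number appears; the code 0 of the empty sequence is let through to keep the search
    total. *)
Lemma odd_iter_half c : exists j, (c == 0) || odd (iter j half c).
Proof.
rewrite -(CodeSeq.decodeK c).
case: (CodeSeq.decode c) => [|n s]; first by exists 0.
exists n => /=; rewrite iter_half_expn // subnn mul1n /= odd_double orbT //.
Qed.

Lemma code_head c : ex_minn (odd_iter_half c) = head 0 (CodeSeq.decode c).
Proof.
case: ex_minnP => j; rewrite -{1 2 3 4}(CodeSeq.decodeK c).
case: (CodeSeq.decode c) => [|n s] /= jP j_min.
  by apply/eqP; rewrite -leqn0 j_min.
apply/eqP; rewrite eqn_leq j_min; last first.
  by rewrite iter_half_expn // subnn mul1n /= odd_double orbT.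
rewrite leqNgt; apply/negP => lt_jn; move: jP.
rewrite muln_eq0 expn_eq0 /= iter_half_expn 1?ltnW // oddM oddX.
by rewrite subn_eq0 leqNgt lt_jn.
Qed.

Lemma R1_code_head : R1 (fun c => head 0 (CodeSeq.decode c)).
Proof.
pose p j v := (nth 0 v 0 == 0) || odd (iter j half (nth 0 v 0)).
apply: (@Rec_ext _ (fun v => ex_minn (odd_iter_half (nth 0 v 0)))).
  by move=> v _; rewrite code_head.
apply: (Rec_mu (p := p)).
apply: Rec_or; first by apply: Rec_eq; rec_var.
by apply: Rec_odd; apply: Rec_iter; [apply: Rec_half| |]; rec_var.
Qed.

Lemma R1_code_behead : R1 (fun c => CodeSeq.code (behead (CodeSeq.decode c))).
Proof.
pose h c := head 0 (CodeSeq.decode c).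
(* Dividing [2 ^ n * (2 * m + 1)] by [2 ^ n] and halving once more leaves the code [m] of the
   tail. *)
apply: (@Rec_ext _ (fun v => (iter (h (nth 0 v 0)) half (nth 0 v 0))./2)).
  move=> v _; rewrite -{2 3}(CodeSeq.decodeK (nth 0 v 0)) CodeSeq.codeK /h.
  case: (CodeSeq.decode _) => //= n s.
  by rewrite iter_half_expn // subnn mul1n /= uphalf_double.
apply: Rec_half; apply: Rec_iter; [apply: Rec_half| |]; try rec_var.
by apply: (R1_app R1_code_head); rec_var.
Qed.

Lemma R2_code_nth : R2 (fun c i => nth 0 (CodeSeq.decode c) i).
Proof.
pose t c := CodeSeq.code (behead (CodeSeq.decode c)).
apply: (@Rec_ext _ (fun v =>
  head 0 (CodeSeq.decode (iter (nth 0 v 1) t (nth 0 v 0))))); last first.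
  apply: (R1_app R1_code_head).
  by apply: (Rec_iter R1_code_behead); apply: Rec_nth.
move=> v _; have -> : iter (nth 0 v 1) t (nth 0 v 0) =
    CodeSeq.code (drop (nth 0 v 1) (CodeSeq.decode (nth 0 v 0))).
  elim: (nth 0 v 1) => [|i /= ->]; first by rewrite drop0 CodeSeq.decodeK.
  by rewrite /t CodeSeq.codeK -drop1 drop_drop.
by rewrite CodeSeq.codeK -nth0 nth_drop addn0.
Qed.

Lemma size_decode c : size (CodeSeq.decode c) <= c.
Proof.
rewrite -{2}(CodeSeq.decodeK c); elim: (CodeSeq.decode c) => //= n s IHs.
apply: leq_trans (leq_pmull _ (expn_gt0 2 n)).
by rewrite ltnS (leq_trans IHs) // -addnn leq_addr.
Qed.

(** The shift matches [onat_code], in which 0 is the pause and [x.+1] the number [x]. *)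
Definition code_mem c x := x.+1 \in CodeSeq.decode c.

Lemma R2_code_mem : R2 code_mem.
Proof.
apply: (@Rec_ext _ (fun v => 0 < \sum_(i < nth 0 v 0)
    (nth 0 (CodeSeq.decode (nth 0 v 0)) i == (nth 0 v 1).+1))).
  move=> v _; congr nat_of_bool; rewrite lt0n sum_nat_eq0 negb_forall.
  apply/existsP/idP => [[i]|/(nthP 0) [i lt_i eq_i]].
    rewrite eqb0 negbK => /eqP eq_i; rewrite /code_mem -eq_i mem_nth //.
    (* Positions beyond the end read the default 0, which is never a successor. *)
    by rewrite ltnNge; apply/negP => /(nth_default 0); rewrite eq_i.
  have lt_i' := leq_trans lt_i (size_decode _).
  by exists (Ordinal lt_i'); rewrite /= eq_i eqxx.
apply: Rec_leq; first by rec_var.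
pose F i v : nat := nth 0 (CodeSeq.decode (nth 0 v 0)) i == (nth 0 v 1).+1.
apply: (Rec_sum (F := F)); first by rec_var.
apply: Rec_eq; first by apply: (R2_app R2_code_nth); rec_var.
by apply: Rec_succ; rec_var.
Qed.

(** * Recursively enumerable predicates *)

Definition RE n (P : seq nat -> Prop) := exists2 f, Rec n.+1 f &
  forall v, size v = n -> (P v <-> exists s, f (s :: v) = 0).

Lemma reP n P : re [set v : n.-tuple nat | P (v : seq nat)] <-> RE n P.
Proof.
split=> [[f recf fP]|[f recf fP]]; last first.
  by exists (fun v => f v) => // v; apply: fP; rewrite size_tuple.
exists (fun v => oapp f 0 (insub v)).
  by move: recf; congr recursive; apply/funext => v; rewrite valK.
move=> v /eqP sz_v; have := fP (Tuple sz_v); rewrite /= => ->.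
by split=> -[s fs]; exists s; move: fs;
  rewrite -[_ :: _]/(val [tuple of s :: Tuple sz_v]) valK.
Qed.

Lemma RE_ext n P Q :
  (forall v, size v = n -> (P v <-> Q v)) -> RE n P -> RE n Q.
Proof. by move=> PQ [f recf fP]; exists f => // v szv; rewrite -PQ ?fP. Qed.

Lemma RE_dec n (b : seq nat -> bool) : Rec n b -> RE n b.
Proof.
move=> recb; exists (fun w => ~~ b (behead w)) => [|v _ /=].
  exact: Rec_neg (Rec_lift recb).
by split=> [->|[_]]; [exists 0 | case: (b v)].
Qed.

Lemma RE_or n P Q : RE n P -> RE n Q -> RE n (fun v => P v \/ Q v).
Proof.
move=> [f recf fP] [g recg gQ]; exists (fun w => f w * g w) => [|v szv].
  exact: Rec_mul.
rewrite fP // gQ //; split=> [[] [s s0]|[s /eqP]].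
- by exists s; rewrite s0.
- by exists s; rewrite s0 muln0.
- by rewrite muln_eq0 => /orP[] /eqP s0; [left|right]; exists s.
Qed.

(** The value [x] and the witness for it are packed into one number, the code of [[:: x; s]]. *)
Lemma RE_ex n P :
  RE n.+1 (fun w => P (nth 0 w 0) (behead w)) ->
  RE n (fun v => exists x, P x v).
Proof.
move=> [f recf fP].
pose proj i w := nth 0 (CodeSeq.decode (nth 0 w 0)) i.
have projE i c v : proj i (c :: v) = nth 0 (CodeSeq.decode c) i by [].
have recproj i : Rec n.+1 (proj i).
  by apply: (R2_app R2_code_nth); rec_var.
exists (fun w => f (proj 1 w :: proj 0 w :: behead w)).
  apply: Rec_subst recf _.
  by do 2!apply: RecL_cons => //; apply: RecL_drop1.
move=> v szv; split=> [[x Px]|[p fp0]]; last first.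
  exists (proj 0 (p :: v)); apply/(fP (_ :: v)); first by rewrite /= szv.
  by exists (proj 1 (p :: v)).
have [s s0] : exists s, f [:: s, x & v] = 0.
  by apply/(fP (x :: v)); rewrite //= szv.
by exists (CodeSeq.code [:: x; s]); rewrite !projE CodeSeq.codeK.
Qed.

Lemma RE_subst n m P X : RE m P -> RecL n m X -> RE n (fun v => P (X v)).
Proof.
move=> [f recf fP] [szX recX]; exists (fun w => f (nth 0 w 0 :: X (behead w))).
  apply: Rec_subst recf (RecL_cons (Rec_nth _ 0) _).
  by split=> [[|x v] // [szv]|i]; [apply: szX | apply: (Rec_lift (recX i))].
by move=> v szv; rewrite (fP _ (szX _ szv)).
Qed.

(** The conjuncts need independent witnesses, hence two existential quantifiers over a decidable
    matrix. *)
Lemma RE_and n P Q : RE n P -> RE n Q -> RE n (fun v => P v /\ Q v).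
Proof.
move=> [f recf fP] [g recg gQ].
pose b s t v := (f (s :: v) == 0) && (g (t :: v) == 0).
have : RE n (fun v => exists s t, b s t v); last first.
  apply: RE_ext => v szv; rewrite fP // gQ //.
  split=> [[s [t /andP[/eqP fs /eqP gt]]]|[[s fs] [t gt]]].
    by split; [exists s | exists t].
  by exists s, t; rewrite /b fs gt.
apply: (RE_ex (P := fun s v => exists t, b s t v)).
apply: (RE_ex (P := fun t v => b (nth 0 v 0) t (behead v))).
have RL2 : RecL n.+2 n (fun w => behead (behead w)).
  by do 2!apply: RecL_behead; apply: RecL_id.
have recs : Rec n.+2 (fun w => nth 0 (behead w) 0) by rec_var.
apply: RE_dec; apply: Rec_and; apply: Rec_eq; try rec_var.
  exact: Rec_subst recf (RecL_cons recs RL2).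
exact: Rec_subst recg (RecL_cons (Rec_nth _ 0) RL2).
Qed.

Lemma re_relP R : re_rel R <-> RE 2 (fun v => R (nth 0 v 0) (nth 0 v 1)).
Proof.
rewrite -reP /re_rel; split; congr re; apply/seteqP; split=> v /=;
  by rewrite !(tnth_nth 0).
Qed.

Lemma re_setP A : re_set A <-> RE 1 (fun v => A (nth 0 v 0)).
Proof.
rewrite -reP /re_set; split; congr re; apply/seteqP; split=> v /=;
  by rewrite /thead !(tnth_nth 0).
Qed.

Lemma RE_rel n R F G :
  re_rel R -> Rec n F -> Rec n G -> RE n (fun v => R (F v) (G v)).
Proof.
move=> /re_relP reR recF recG.
exact: RE_subst reR (RecL_cons recF (RecL_cons recG (RecL_nil n))).
Qed.

Lemma RE_set n A F : re_set A -> Rec n F -> RE n (fun v => A (F v)).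
Proof.
by move=> /re_setP reA recF; apply: RE_subst reA (RecL_cons recF (RecL_nil n)).
Qed.

(** Every number is read as a candidate together with a stage; where the stage does not confirm the
    candidate, the known element [x0] is output, so the enumeration is total. *)
Lemma re_set_enum A x0 : re_set A -> A x0 ->
  exists2 a, R1 a & range a = A.
Proof.
move=> /re_setP [f recf fA] Ax0.
pose x c := nth 0 (CodeSeq.decode c) 0.
pose b c := f [:: nth 0 (CodeSeq.decode c) 1; x c] == 0.
have recx : Rec 1 (fun v => x (nth 0 v 0)).
  by apply: (R2_app R2_code_nth); rec_var.
exists (fun c => if b c then x c else x0).
  apply: (Rec_if _ recx (Rec_const _ _)); apply: Rec_eq; last by rec_var.
  apply: Rec_subst recf (RecL_cons _ (RecL_cons recx (RecL_nil _))).
  by apply: (R2_app R2_code_nth); rec_var.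
apply/seteqP; split=> y.
  move=> [c _ <-]; case: ifP => // /eqP bc.
  by apply/(fA [:: x c]) => //; exists (nth 0 (CodeSeq.decode c) 1).
move=> Ay; have [s s0] : exists s, f [:: s; y] = 0 by apply/(fA [:: y]).
exists (CodeSeq.code [:: y; s]) => //.
by rewrite /b /x CodeSeq.codeK [nth _ _ _]/= s0.
Qed.

(** * Texts and telltales *)

Lemma code_mem_seq_code s x : code_mem (seq_code s) x = (Some x \in s).
Proof.
rewrite /code_mem /seq_code CodeSeq.codeK.
by apply/mapP/idP => [[[y|] // s_y [->]]|sx] //; exists (Some x).
Qed.

Lemma cnt_seqE T n x :
  cnt_seq (initial_segment T n) x <-> exists2 i, i < n & T i = Some x.
Proof.
rewrite /cnt_seq /=; split=> [/mapP[i]|[i lt_in Ti]].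
  by rewrite mem_iota => lt_in ->; exists i.
by apply/mapP; exists i; rewrite ?mem_iota.
Qed.

Lemma initial_segment_sub T n k x :
  Some x \in initial_segment T n -> Some x \in initial_segment T (n + k).
Proof.
move=> /cnt_seqE[i lt_in Ti]; apply/cnt_seqE; exists i => //.
exact: leq_trans lt_in (leq_addr _ _).
Qed.

Lemma take_initial_segment T n m : n <= m ->
  take n (initial_segment T m) = initial_segment T n.
Proof.
move=> /minn_idPl le_nm.
by rewrite /initial_segment /mkseq -map_take take_iota le_nm.
Qed.

Lemma text_extension (L : set nat) s : cnt_seq s `<=` L ->
  exists2 T, text_for T L & initial_segment T (size s) = s.
Proof.
move=> sL; pose T n := if n < size s then nth None s n
  else if `[<L (n - size s)>] then Some (n - size s) else None.
exists T.
  apply/seteqP; split=> x.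
    move=> [n]; rewrite /T; case: ifP => [lt_n eq_x|_].
      by apply: sL; rewrite /cnt_seq /= -eq_x mem_nth.
    by case: asboolP => // Ln [<-].
  move=> Lx; exists (size s + x).
  by rewrite /T ltnNge leq_addr /= addKn asboolT.
apply: (@eq_from_nth _ None); rewrite size_mkseq // => i lt_i.
by rewrite nth_mkseq // /T lt_i.
Qed.

Lemma cnt_seq_text T L n : text_for T L -> cnt_seq (initial_segment T n) `<=` L.
Proof. by move=> <- x /cnt_seqE[i _ Ti]; exists i. Qed.

Lemma seq_in_text T L (D : seq nat) :
    text_for T L -> (forall x, x \in D -> L x) ->
  exists m, forall n, m <= n -> forall x, x \in D ->
    Some x \in initial_segment T n.
Proof.
move=> TL; elim: D => [|x D IHD] DL; first by exists 0.
have [|m mP] := IHD; first by move=> y Dy; apply: DL; rewrite inE Dy orbT.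
have [i Ti] : cnt T x by rewrite TL; apply: DL; rewrite mem_head.
exists (maxn m i.+1) => n; rewrite geq_max => /andP[le_mn lt_in] y.
by rewrite inE => /predU1P[->|/mP->//]; apply/cnt_seqE; exists i.
Qed.

Lemma Ex_BC H C M : Ex_learns H C M -> BC_learns H C M.
Proof.
move=> exM L T CL TL; have [e He [m mP]] := exM L T CL TL.
by exists m => n /mP Mn; exists e.
Qed.

Lemma text_union (s : nat -> seq (option nat)) :
    (forall n, exists r, s n.+1 = s n ++ r) -> (forall n, n <= size (s n)) ->
  exists T : text, forall n, initial_segment T (size (s n)) = s n.
Proof.
move=> s_ext sz_s; pose T n := nth None (s n.+1) n.
have s_nth n m i : n <= m -> i < size (s n) ->
    nth None (s m) i = nth None (s n) i.
  move=> /subnK <- lt_i; elim: (m - n) => // d IHd; rewrite addSn.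
  have [r ->] := s_ext (d + n); rewrite nth_cat IHd ifT //.
  elim: d {IHd} => //= d; rewrite addSn; have [r' ->] := s_ext (d + n).
  by rewrite size_cat => /leq_trans; apply; apply: leq_addr.
exists T => n; apply: (@eq_from_nth _ None); rewrite size_mkseq // => i lt_i.
rewrite nth_mkseq // /T; case: (leqP n i.+1) => [le_n|/ltnW le_i].
  exact: s_nth.
by apply/esym/s_nth.
Qed.

(** A text for [L] beginning with [s] is followed until the learner has converged. *)
Lemma BC_extension H C M L s : BC_learns H C M -> C L -> cnt_seq s `<=` L ->
  exists r e, [/\ M (s ++ r) = Some e, H e = L & cnt_seq (s ++ r) `<=` L].
Proof.
move=> bcM CL sL; have [T TL Ts] := text_extension sL.
have [m mP] := bcM L T CL TL.
have [e Me He] := mP (size s + m) (leq_addl _ _).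
exists (drop (size s) (initial_segment T (size s + m))), e.
have -> : s ++ drop (size s) (initial_segment T (size s + m)) =
    initial_segment T (size s + m).
  by rewrite -{1}Ts -(take_initial_segment T (leq_addr m _)) cat_take_drop.
by split=> //; apply: cnt_seq_text.
Qed.

(* Blum and Blum's locking argument: without a telltale, a text for N can be
   assembled on which infinitely many conjectures are wrong. *)
Lemma BC_telltale H C M : BC_learns H C M -> C setT ->
  exists D : seq nat, forall L, C L -> (forall x, x \in D -> L x) -> L = setT.
Proof.
move=> bcM CT; apply: contrapT => noD.
(* Otherwise the content of [s] would be a telltale: by [BC_extension], a member other than N
   containing it is conjectured after some extension of [s]. *)
have step (s : seq (option nat)) : exists r,
    exists2 e, M (s ++ r) = Some e & H e <> setT.
  apply: contrapT => noR; apply: noD; exists (pmap id s) => L CL sL.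
  apply: contrapT => LT; apply: noR.
  have [|r [e [Mr He _]]] := BC_extension (s := s) bcM CL.
    by move=> x sx; apply: sL; rewrite mem_pmap map_id.
  by exists r, e; rewrite // He.
have [r rP] := choice step.
(* Each round provokes a wrong conjecture and then adds the number [n], so that the limit is a text
   for N. *)
pose sg := nat_rect (fun=> seq (option nat)) [::]
  (fun n s => rcons (s ++ r s) (Some n)).
have [|n|T Tsg] := @text_union sg.
- by move=> n; exists (rcons (r (sg n)) (Some n)); rewrite -rcons_cat.
- elim: n => //= n IHn.
  by rewrite size_rcons size_cat ltnS (leq_trans IHn) ?leq_addr.
have sz_sg n : n <= size (sg n).
  elim: n => //= n IHn.
  by rewrite size_rcons size_cat ltnS (leq_trans IHn) ?leq_addr.
have TT : text_for T setT.
  apply/seteqP; split=> // x _.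
  have /cnt_seqE[i _ Ti] : cnt_seq (initial_segment T (size (sg x.+1))) x.
    by rewrite Tsg /cnt_seq /= mem_rcons mem_head.
  by exists i.
have [m mP] := bcM _ _ CT TT.
have [e Me He] := rP (sg m).
have := mP (size (sg m ++ r (sg m))); rewrite size_cat.
case=> [|e' ]; first by rewrite (leq_trans (sz_sg m)) ?leq_addr.
have lt_m : size (sg m) + size (r (sg m)) <= size (sg m.+1).
  by rewrite /= size_rcons size_cat.
rewrite -(take_initial_segment T lt_m) Tsg /= -cats1 -size_cat take_size_cat //.
by rewrite Me => -[<-] /He.
Qed.

(** * Learning families of closed sets *)

Section PositiveEquivalence.
Variables (eta : nat -> nat -> Prop).
Hypothesis eqv : RelationClasses.Equivalence eta.

Lemma eta_closedP A :
  eta_closed eta A <-> forall x y, A x -> eta x y -> A y.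
Proof.
split=> [[K Keta ->] x y [c Kc cx] xy|Acl].
  exists c => //; have [z _ eq_c] := Keta _ Kc.
  by move: cx; rewrite -eq_c => zx; transitivity x.
exists [set c | exists2 x, A x & c = eta x] => [c [x _ ->]|]; first by exists x.
apply/seteqP; split=> [x Ax|y [_ [x Ax ->] xy]]; last exact: Acl xy.
by exists (eta x); [exists x | reflexivity].
Qed.

Lemma eta_closed_closure A : eta_closed eta A -> eta_closure eta A = A.
Proof.
move=> /eta_closedP Acl; apply/seteqP; split=> [y [x Ax xy]|x Ax].
  exact: Acl xy.
by exists x => //; reflexivity.
Qed.

(** A finite list of representatives yields all classes as a finite image; conversely, finitely many
    classes have finitely many chosen representatives. *)
Lemma eta_infiniteP A : eta_infinite eta A <->
  eta_closed eta A /\ ~ exists s : seq nat, (forall x, x \in s -> A x) /\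
    forall x, A x -> exists2 y, y \in s & eta y x.
Proof.
split=> [[K [Keta Kinf AK]]|[Acl ninf]].
  have Acl : eta_closed eta A by exists K.
  split=> // -[s [_ sP]]; apply: Kinf.
  apply: (@sub_finite_set _ _ [set (eta x : set nat) | x in [set` s]]).
    move=> c Kc; have [z _ eq_c] := Keta _ Kc.
    have Az : A z by rewrite AK; exists c => //; rewrite -eq_c; reflexivity.
    have [y sy yz] := sP _ Az; exists y => //; rewrite -eq_c.
    apply/seteqP; split=> x; last by transitivity z.
    by transitivity y => //; symmetry.
  exact/finite_image/finite_seq.
exists [set (eta x : set nat) | x in A]; split.
- by move=> _ [x _ <-]; exists x.
- move=> fin; apply: ninf.
  have /finite_seqP[cs eq_cs] := fin.
  have [s [sA sP]] : exists s : seq nat, (forall x, x \in s -> A x) /\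
      forall c, c \in cs -> exists2 x, x \in s & eta x = c.
    have: forall c, c \in cs -> exists2 x, A x & eta x = c.
      by move=> c cs_c; have: [set` cs] c by []; rewrite -eq_cs.
    elim: cs {eq_cs} => [|c cs IHcs] csA; first by exists [::].
    have [|s [sA sP]] := IHcs.
      by move=> d cs_d; apply: csA; rewrite inE cs_d orbT.
    have [x Ax xc] := csA c (mem_head _ _).
    exists (x :: s); split=> [y|d]; rewrite inE => /predU1P[->//|].
    - exact: sA.
    - by exists x => //; rewrite mem_head.
    - by move=> /sP[y sy yd]; exists y => //; rewrite inE sy orbT.
  exists s; split=> // x Ax.
  have /sP[y sy yx] : eta x \in cs.
    by have: [set` cs] (eta x) by rewrite -eq_cs; exists x.
  by exists y => //; rewrite yx; reflexivity.
- apply/seteqP; split=> [x Ax|y [_ [x Ax <-] xy]].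
    by exists (eta x); [exists x | reflexivity].
  by move/eta_closedP: Acl; apply; first exact: Ax.
Qed.

Section Acceptable.
Variable W : nat -> set nat.
Hypothesis accW : acceptable W.

(** Acceptability translates indices of [H] into indices of [W], and passing to closures leaves the
    members of the family unchanged, as they are closed already. *)
Lemma class_preserving_Ex_learnable C : eta_family eta C ->
  class_preservingly_weakly_monotonically_Ex_learnable C ->
  Ex_learnable W eta C.
Proof.
move=> [_ Ccl _] [H [M [[reH rangeH] [m recm mM] exM _]]].
have [f /R1P recf fH] := accW.2 H reH.
exists (fun s => omap f (M s)).
  exists (fun c => if m c == 0 then 0 else (f (m c).-1).+1) => [|s].
    move/R1P: recm => recm; apply/R1P; apply: Rec_if.
    - by apply: Rec_eq => //; rec_var.
    - by rec_var.
    - by apply: Rec_succ; apply: (R1_app recf); apply: Rec_pred.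
  by rewrite mM; case: (M s).
move=> L T CL TL; have [e He [n nP]] := exM L T CL TL.
exists (f e).
  by rewrite /default_hyp -fH eta_closed_closure He //; apply: Ccl.
by exists n => k /nP ->.
Qed.

Lemma monotonically_BC_learnable_of_infinite_setT C :
    eta_family eta C -> Ex_learnable W eta C ->
    (forall A, eta_infinite eta A -> re_set A -> A = setT) ->
  monotonically_BC_learnable W eta C.
Proof.
move=> [_ Ccl [B [reB _ rangeB]]] [M _ exM] infT.
have reC L : C L -> re_set L.
  rewrite -rangeB => -[k _ <-].
  by apply/re_setP; apply: (RE_rel reB); rec_var.
have finC L : C L -> L <> setT -> exists s : seq nat,
    (forall x, x \in s -> L x) /\ forall x, L x -> exists2 y, y \in s & eta y x.
  move=> CL LT; apply: contrapT => ninf; apply: LT; apply: infT (reC _ CL).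
  by apply/eta_infiniteP; split=> //; apply: Ccl.
(* [b] records classically whether N belongs to the family; if it does not, the switch to N is
   disabled and [D] is a dummy. *)
have [b [D [bT bD]]] : exists (b : bool) (D : seq nat), (C setT -> b) /\
    (b -> forall L, C L -> (forall x, x \in D -> L x) -> L = setT).
  case: (pselect (C setT)) => CT; last by exists false, [::].
  by have [D DP] := BC_telltale (Ex_BC exM) CT; exists true, D.
pose full c := b && all (code_mem c) D.
pose V c : set nat := [set x | code_mem c x || full c].
have reV : uniformly_re V.
  apply/re_relP; apply: RE_dec; apply: Rec_or; first exact: R2_code_mem.
  rewrite /full; apply: Rec_and; first by rec_var.
  elim: D {bD full V} => [|x D IHD] /=; first by rec_var.
  by apply: Rec_and => //; apply: (R2_app R2_code_mem); rec_var.
have [f /R1P recf fV] := accW.2 V reV.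
have VE s x : V (seq_code s) x <-> Some x \in s \/ full (seq_code s).
  by rewrite /V /= code_mem_seq_code; split=> /orP.
have fullE s : full (seq_code s) = b && all (fun x => Some x \in s) D.
  by rewrite /full; congr andb; apply: eq_all => x; rewrite code_mem_seq_code.
(* No conjecture overshoots the target: data from [L] containing [D] force [L] to be N. *)
have V_text s L : C L -> cnt_seq s `<=` L -> V (seq_code s) `<=` L.
  move=> CL sL x /VE[/sL //|]; rewrite fullE => /andP[hb /allP sD].
  by rewrite (bD hb L CL) // => y /sD; apply: sL.
exists (fun s => Some (f (seq_code s))); split.
- exists (fun c => (f c).+1) => //; apply/R1P.
  by apply: Rec_succ; apply: (R1_app recf); rec_var.
- move=> L T CL TL.
  suff [m mP] : exists m, forall n, m <= n ->
      L `<=` eta_closure eta (V (seq_code (initial_segment T n))).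
    exists m => n /mP LV; exists (f (seq_code (initial_segment T n))) => //.
    rewrite /default_hyp -fV; apply/seteqP; split=> // y [x Vx xy].
    move/eta_closedP: (Ccl _ CL); apply; last exact: xy.
    by apply: V_text Vx => //; apply: cnt_seq_text.
  (* For N the data must come to contain [D]; for another member, a representative of each of its
     finitely many classes. *)
  case: (pselect (L = setT)) => [LT|LnT].
    have CT : C setT by rewrite -LT.
    have [x _|m mP] := @seq_in_text T L D TL; first by rewrite LT.
    exists m => n /mP nP y _; exists y; last by reflexivity.
    by apply/VE; right; rewrite fullE bT //; apply/allP => x /nP.
  have [s [sL sP]] := finC L CL LnT.
  have [m mP] := seq_in_text TL sL.
  exists m => n /mP nP x /sP[y /nP sy yx]; exists y => //.
  by apply/VE; left.
(* The hypotheses grow with the data, even outside the target. *)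
- move=> L T CL TL n k i j [<-] [<-]; apply: setSI.
  rewrite /default_hyp -!fV => y [x Vx xy]; exists x => //.
  apply/VE; move/VE: Vx => [/initial_segment_sub ?|fullx]; [by left|right].
  move: fullx; rewrite !fullE => /andP[-> /allP sD]; apply/allP => z /sD.
  exact: initial_segment_sub.
Qed.

End Acceptable.
(** * The chain below an infinite r.e. set *)

Section Chain.
Hypothesis re_eta : re_rel eta.
Variables (A : set nat) (a : nat) (en : nat -> nat).
Hypotheses (Acl : forall x y, A x -> eta x y -> A y) (reA : re_set A).
Hypothesis Ainf :
  forall s : seq nat, exists2 x, A x & forall y, y \in s -> ~ eta y x.
Hypotheses (NAa : ~ A a) (ren : R1 en) (enA : range en = A).

Definition chain k : set nat :=
  [set x | eta a x \/ exists2 i, i < k & eta (en i) x].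

(* Counting classes gives a one-one numbering: [chain k] is the [n]-th set in
   the chain exactly if the first [k] members of [A] meet [n] classes, and "at
   most [n] classes" is an r.e. condition, whereas repetitions in [chain_hyp]
   are only r.e. to detect. *)
Definition fresh i : bool := `[<forall j, j < i -> ~ eta (en j) (en i)>].

Definition nclasses k := \sum_(i < k) fresh i.

Definition chain_sum n : set nat :=
  if n is m.+1 then
    [set x | eta a x \/ exists2 i, nclasses i.+1 <= m & eta (en i) x]
  else A.

(** The hypothesis space of the learner below. Repetitions are harmless there, and the search for an
    unseen [en k] yields the index [k.+1] directly. *)
Definition chain_hyp n : set nat := if n is k.+1 then chain k else A.

Lemma A_en i : A (en i). Proof. by rewrite -enA; exists i. Qed.

Lemma eta_aA x : A x -> ~ eta a x.
Proof. by move=> Ax ax; apply: NAa; apply: Acl Ax _; symmetry. Qed.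

Lemma chain_closed k x y : chain k x -> eta x y -> chain k y.
Proof.
move=> [ax|[i lt_i ix]] xy; [left; transitivity x | right] => //.
by exists i => //; transitivity x.
Qed.

Lemma chain_en k i : i < k -> chain k (en i).
Proof. by move=> lt_i; right; exists i => //; reflexivity. Qed.

Lemma chain_le k l : k <= l -> chain k `<=` chain l.
Proof.
move=> le_kl x [|[i lt_i ix]]; [by left | right; exists i => //].
exact: leq_trans lt_i le_kl.
Qed.

(** The class of [a] misses [A], and the first [k] elements represent only finitely many of the
    classes in [A]. *)
Lemma chain_escape k : exists i, ~ chain k (en i).
Proof.
have [x] := Ainf (map en (iota 0 k)); rewrite -enA => -[i _ <-] enx.
exists i => -[/(eta_aA (A_en i)) //|[j lt_j]].
by apply: enx; apply: map_f; rewrite mem_iota.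
Qed.

Lemma nclassesS k : nclasses k.+1 = nclasses k + fresh k.
Proof. by rewrite /nclasses big_ord_recr. Qed.

Lemma nclasses_le k l : k <= l -> nclasses k <= nclasses l.
Proof.
move/subnK <-; elim: (l - k) => // d /leq_trans; apply.
by rewrite addSn nclassesS leq_addr.
Qed.

Lemma fresh_repr i : exists j, [/\ j <= i, fresh j & eta (en j) (en i)].
Proof.
elim/ltn_ind: i => i IHi; case: (boolP (fresh i)) => [fri|/asboolPn].
  by exists i; split=> //; reflexivity.
move=> /existsNP[j /not_implyP[lt_ji /contrapT ji]].
have [l [le_l frl lj]] := IHi j lt_ji.
exists l; split=> //; last by transitivity (en j).
exact: leq_trans le_l (ltnW lt_ji).
Qed.

(** The first index of the class of [en i] must be below [k]: otherwise that class would be counted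
    only after stage [k], and [nclasses i.+1] would exceed [nclasses k]. *)
Lemma nclasses_repr i k : nclasses i.+1 <= nclasses k ->
  exists2 j, j < k & eta (en j) (en i).
Proof.
move=> le_ik; have [j [le_ji frj ji]] := fresh_repr i.
exists j => //; rewrite ltnNge; apply/negP => /nclasses_le le_kj.
have := nclasses_le (le_ji : j < i.+1); rewrite nclassesS frj addn1.
by rewrite ltnNge (leq_trans le_ik le_kj).
Qed.

Lemma chain_sumE k : chain_sum (nclasses k).+1 = chain k.
Proof.
apply/seteqP; split=> x [ax|[i]]; try by left.
  move=> /nclasses_repr[j lt_j ji] ix; right; exists j => //.
  by transitivity (en i).
by move=> lt_i ix; right; exists i => //; apply: nclasses_le.
Qed.

(** Indices that are not fresh leave the count unchanged, so one may pass from [k] to the next fresh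
    index, which exists by [chain_escape]. *)
Lemma fresh_next k : exists2 l, fresh l & nclasses l = nclasses k.
Proof.
have [i Ni] := chain_escape k; have [j [le_j frj ji]] := fresh_repr i.
have le_kj : k <= j.
  by rewrite leqNgt; apply/negP => lt_j; apply: Ni; right; exists j.
move: (subnK le_kj); move: (j - k) => d.
elim: d k {Ni le_kj} => [|d IHd] k dk; first by exists j => //; rewrite -dk.
case: (boolP (fresh k)) => frk; first by exists k.
have [|l frl eq_l] := IHd k.+1; first by rewrite addnS.
by exists l => //; rewrite eq_l nclassesS (negPf frk) addn0.
Qed.

Lemma nclasses_onto n : exists2 k, fresh k & nclasses k = n.
Proof.
elim: n => [|n [k frk <-]].
  have [l frl eq_l] := fresh_next 0.
  by exists l; rewrite // eq_l /nclasses big_ord0.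
have [l frl eq_l] := fresh_next k.+1; exists l => //.
by rewrite eq_l nclassesS frk addn1.
Qed.

Lemma chain_sum_inj : injective chain_sum.
Proof.
have lt_neq m n : m < n -> chain_sum m <> chain_sum n.
  case: m n => [|m] [|n] // lt_mn eq_mn.
    by apply: NAa; rewrite -[A]/(chain_sum 0) eq_mn; left; reflexivity.
  (* The fresh [en k] with [nclasses k = m] first enters at index [m.+2], and so separates
     [chain_sum m.+1] from all later sets. *)
  have [k frk eq_k] := nclasses_onto m.
  have: chain_sum n.+1 (en k).
    right; exists k; last by reflexivity.
    by rewrite nclassesS frk addn1 eq_k.
  rewrite -eq_mn -eq_k chain_sumE => -[/(eta_aA (A_en k)) //|[i]].
  by move/asboolP: frk; apply.
by move=> m n eq_mn; case: (ltngtP m n) => // /lt_neq; rewrite eq_mn.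
Qed.

Lemma range_chain_sum : range chain_sum = range chain_hyp.
Proof.
apply/seteqP; split=> _ [[|n] _ <-]; try by exists 0.
  by have [k _ <-] := nclasses_onto n; exists k.+1 => //; rewrite chain_sumE.
by exists (nclasses n).+1 => //; rewrite chain_sumE.
Qed.

(** * Enumerability of the two numberings *)

Lemma re_chain_hyp : uniformly_re chain_hyp.
Proof.
(* Here [k] is an index of [chain_hyp], one more than the number of elements of [A] used. *)
pose R k i x := i.+1 < k /\ eta (en i) x.
apply/re_relP; apply: (@RE_ext _ (fun v =>
    (nth 0 v 0 == 0 /\ A (nth 0 v 1)) \/
    (0 < nth 0 v 0 /\ (eta a (nth 0 v 1) \/
       exists i, R (nth 0 v 0) i (nth 0 v 1))))).
  move=> v _; case: (nth 0 v 0) => [|k] /=.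
    by split=> [[[]|[]] //|]; left.
  split=> [[[]//|[_ [|[i []]]]]|[|[i]]].
  - by left.
  - by right; exists i.
  - by right; split=> //; left.
  - by right; split=> //; right; exists i.
apply: RE_or; apply: RE_and.
- by apply: RE_dec; apply: Rec_eq; rec_var.
- by apply: RE_set => //; rec_var.
- by apply: RE_dec; apply: Rec_leq; rec_var.
apply: RE_or; first by apply: RE_rel => //; rec_var.
apply: (RE_ex (P := fun i v => R (nth 0 v 0) i (nth 0 v 1))).
apply: RE_and.
  by apply: RE_dec; apply: Rec_leq; [do 2!apply: Rec_succ|]; rec_var.
by apply: RE_rel => //; [apply: (R1_app ren)|]; rec_var.
Qed.

(* Approximating [eta] from below approximates the class count from above. *)
Lemma nclasses_approx : exists2 c, Rec 2 (fun v => c (nth 0 v 0) (nth 0 v 1)) &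
  forall k n, nclasses k <= n <-> exists s, c s k <= n.
Proof.
have [e rece eP] := (re_relP eta).1 re_eta.
(* [E s i j] counts the witnesses below [s] that [en j] and [en i] are equivalent; [F s i] is 1 as
   long as no equivalent earlier element is found. *)
pose E s i j : nat := \sum_(t < s) (e [:: (t : nat); en j; en i] == 0).
pose F s i : nat := \sum_(j < i) E s i j == 0.
exists (fun s k => \sum_(i < k) F s i).
  apply: (Rec_sum (N := fun v => nth 0 v 1) (F := fun i v => F (nth 0 v 0) i)).
    by rec_var.
  apply: Rec_eq; last by rec_var.
  apply: (Rec_sum (N := fun v => nth 0 v 0)
    (F := fun j v => E (nth 0 (behead v) 0) (nth 0 v 0) j)); first by rec_var.
  apply: (Rec_sum (N := fun v => nth 0 (behead (behead v)) 0)
    (F := fun t v =>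
      e [:: t; en (nth 0 v 0); en (nth 0 (behead v) 0)] == 0 : nat)).
    by rec_var.
  apply: Rec_eq; last by rec_var.
  apply: (Rec_subst rece); do 3?apply: RecL_cons; try exact: RecL_nil.
  - by rec_var.
  - by apply: (R1_app ren); rec_var.
  - by apply: (R1_app ren); rec_var.
have etaP i j : eta (en j) (en i) <-> exists t, e [:: t; en j; en i] = 0.
  exact: (eP [:: en j; en i]).
have le_fresh s i : fresh i <= F s i.
  rewrite /F; case: (boolP (fresh i)) => // /asboolP fri.
  rewrite big1 // => j _; rewrite /E big1 // => t _.
  apply/eqP; rewrite eqb0; apply/negP => /eqP et.
  by apply: (fri j) => //; apply/etaP; exists t.
have F_fresh i : exists s, forall s', s <= s' -> F s' i = fresh i.
  case: (boolP (fresh i)) => fri.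
    exists 0 => s _; apply/eqP; rewrite eqn_leq; apply/andP; split.
      exact: leq_b1.
    by move: (le_fresh s i); rewrite fri.
  have /asboolPn/existsNP[j /not_implyP[lt_ji /contrapT/etaP[t et]]] := fri.
  exists t.+1 => s lt_ts; apply/eqP; rewrite eqb0 sum_nat_eq0 negb_forall.
  apply/existsP; exists (Ordinal lt_ji); rewrite /= sum_nat_eq0 negb_forall.
  by apply/existsP; exists (Ordinal lt_ts); rewrite /= et.
move=> k n; split=> [le_kn|[s]]; last first.
  by apply: leq_trans; apply: leq_sum => i _; apply: le_fresh.
(* Each of the finitely many summands is eventually correct, so from some stage on the whole sum is
   exact. *)
suff [s sP] : exists s, forall s', s <= s' -> \sum_(i < k) F s' i = nclasses k.
  by exists s; rewrite sP.
elim: k {le_kn} => [|k [s sP]].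
  by exists 0 => s _; rewrite /nclasses !big_ord0.
have [t tP] := F_fresh k.
exists (maxn s t) => u; rewrite geq_max => /andP[le_su le_tu].
by rewrite big_ord_recr /= sP // tP // nclassesS.
Qed.

(** By [nclasses_approx] the bound on the class count becomes the existence of a stage [s]. *)
Lemma re_chain_sum : uniformly_re chain_sum.
Proof.
have [c recc cP] := nclasses_approx.
pose R s i k x := c s i.+1 < k /\ eta (en i) x.
apply/re_relP; apply: (@RE_ext _ (fun v =>
    (nth 0 v 0 == 0 /\ A (nth 0 v 1)) \/
    (0 < nth 0 v 0 /\ (eta a (nth 0 v 1) \/
       exists i s, R s i (nth 0 v 0) (nth 0 v 1))))).
  move=> v _; case: (nth 0 v 0) => [|n] /=.
    by split=> [[[]|[]] //|]; left.
  split=> [[[]//|[_ [|[i [s [le_s ix]]]]]]|[|[i /cP[s le_s] ix]]].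
  - by left.
  - by right; exists i => //; apply/cP; exists s.
  - by right; split=> //; left.
  - by right; split=> //; right; exists i, s.
apply: RE_or; apply: RE_and.
- by apply: RE_dec; apply: Rec_eq; rec_var.
- by apply: RE_set => //; rec_var.
- by apply: RE_dec; apply: Rec_leq; rec_var.
apply: RE_or; first by apply: RE_rel => //; rec_var.
apply: (RE_ex (P := fun i v => exists s, R s i (nth 0 v 0) (nth 0 v 1))).
apply: (RE_ex (P := fun s v =>
  R s (nth 0 v 0) (nth 0 (behead v) 0) (nth 0 (behead v) 1))).
apply: RE_and.
  apply: RE_dec; apply: Rec_leq; last by rec_var.
  by apply: Rec_succ; apply: (R2_app recc); [|apply: Rec_succ]; rec_var.
by apply: RE_rel => //; [apply: (R1_app ren)|]; rec_var.
Qed.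

Lemma chain_family : eta_family eta (range chain_hyp).
Proof.
split; last 1 first.
- exists chain_sum; split; [exact: re_chain_sum | exact: chain_sum_inj|].
  exact: range_chain_sum.
- rewrite -range_chain_sum (eq_finite_set (inj_card_eq (in2W chain_sum_inj))).
  exact: infinite_nat.
- move=> _ [[|k] _ <-]; apply/eta_closedP; first exact: Acl.
  exact: chain_closed.
Qed.

(** * A learner for the chain *)

Lemma code_mem_miss c : exists k, ~~ code_mem c (en k).
Proof.
(* [predn] undoes the shift in the codes; finitely many data cannot meet all classes in [A], so the
   search for an unseen element always ends. *)
have [x] := Ainf (map predn (CodeSeq.decode c)); rewrite -enA => -[k _ <-] ck.
exists k; apply/negP => /(map_f predn)/ck; apply; reflexivity.
Qed.

Definition chain_learner s : option nat :=
  Some (if code_mem (seq_code s) a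
        then (ex_minn (code_mem_miss (seq_code s))).+1
        else 0).

Lemma learner_chain : learner chain_learner.
Proof.
pose g c := if code_mem c a then (ex_minn (code_mem_miss c)).+1 else 0.
exists (fun c => (g c).+1) => //; apply/R1P; apply: Rec_succ; apply: Rec_if.
- by apply: (R2_app R2_code_mem); rec_var.
- apply: Rec_succ.
  apply: (Rec_mu (p := fun k v => ~~ code_mem (nth 0 v 0) (en k))
    (fun v => code_mem_miss (nth 0 v 0))).
  apply: Rec_neg; apply: (R2_app R2_code_mem); first by rec_var.
  by apply: (R1_app ren); rec_var.
- by rec_var.
Qed.

Lemma chain_learner_Ex : Ex_learns chain_hyp (range chain_hyp) chain_learner.
Proof.
move=> _ T [[|k] _ <-] TL.
  exists 0 => //; exists 0 => n _.
  rewrite /chain_learner code_mem_seq_code ifN //.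
  by apply/negP => Ta; apply: NAa; apply: (cnt_seq_text TL Ta).
(* The learner need not find [k]: it settles on [l], the least index with [en l] outside [chain k],
   and [chain l] is the same set. *)
have [l Nl l_min] :
    exists2 l, ~ chain k (en l) & forall i, i < l -> chain k (en i).
  have ex : exists i, ~~ `[<chain k (en i)>].
    by have [i Ni] := chain_escape k; exists i; apply/asboolPn.
  case: (ex_minnP ex) => l /asboolPn Nl l_min; exists l => // i lt_il.
  by apply: contrapT => /asboolPn/l_min; rewrite leqNgt lt_il.
have le_kl : k <= l by rewrite leqNgt; apply/negP => /chain_en.
exists l.+1.
  apply/seteqP; split; last exact: chain_le.
  by move=> x [|[i /l_min li ix]]; [left | apply: chain_closed ix].
have [x|m mP] := @seq_in_text T _ (a :: map en (iota 0 l)) TL.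
  rewrite inE => /predU1P[->|/mapP[i]]; first by left; reflexivity.
  by rewrite mem_iota => /l_min li ->.
exists m => n /mP nP; rewrite /chain_learner code_mem_seq_code nP ?mem_head //.
congr (Some _.+1); case: ex_minnP => i.
rewrite code_mem_seq_code => /negP Ni i_min.
apply/eqP; rewrite eqn_leq i_min ?code_mem_seq_code; last first.
  by apply/negP => Tl; apply: Nl; apply: (cnt_seq_text TL Tl).
rewrite leqNgt; apply/negP => lt_il; apply: Ni; apply: nP.
by rewrite inE map_f ?orbT // mem_iota.
Qed.

(** Once [a] has been seen, the least unseen index can only grow, and the chain with it. Leaving the
    conjecture [A] requires [a] in the data, which then are not contained in [A]. *)
Lemma chain_learner_weakly_monotonic : weakly_monotonic chain_hyp chain_learner.
Proof.
move=> T n k i j [<-] [<-]; rewrite !code_mem_seq_code.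
case: ifP => [/initial_segment_sub -> _|_].
  apply: chain_le; case: ex_minnP => l _ l_min; case: ex_minnP => m.
  rewrite code_mem_seq_code => Nm _; apply: l_min; rewrite code_mem_seq_code.
  by apply: contraNN Nm; apply: initial_segment_sub.
case: ifP => [Ta TA|_ _] //; case: NAa.
exact: TA _ Ta.
Qed.

Lemma seq_sub_chain s : cnt_seq s `<=` A -> exists k, cnt_seq s `<=` chain k.
Proof.
elim: s => [|o s IHs] sA; first by exists 0.
have [x sx|k sk] := IHs; first by apply: sA; rewrite /cnt_seq /= inE sx orbT.
case: o sA => [x|] sA.
  have: A x by apply: sA; rewrite /cnt_seq /= mem_head.
  rewrite -enA => -[i _ enx]; exists (maxn k i.+1) => y.
  rewrite /cnt_seq /= inE => /predU1P[[->]|/sk].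
    by rewrite -enx; apply: chain_en; apply: leq_maxr.
  by apply: chain_le; apply: leq_maxl.
by exists k => y; rewrite /cnt_seq /= inE => /predU1P[|/sk].
Qed.

(* On A, then on [chain k], then on a larger member of the chain: the second
   conjecture drops an element of A belonging to the final target. *)
Lemma chain_not_monotonic H M :
  BC_learns H (range chain_hyp) M -> ~ monotonic H (range chain_hyp) M.
Proof.
move=> bcM monM.
have CA : range chain_hyp A by exists 0.
have Cchain k : range chain_hyp (chain k) by exists k.+1.
have [|s [e [Ms He sA]]] := BC_extension (s := [::]) bcM CA; first by [].
have [k sk] := seq_sub_chain sA.
have [r [f [Mr Hf rk]]] := BC_extension bcM (Cchain k) sk.
have [i Ni] := chain_escape k.
(* [en i] is in [A] and outside [chain k] but in [chain i.+1], which includes [chain k]; the text is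
   completed to this larger set. *)
have le_ki : k <= i.+1.
  by apply/ltnW; rewrite ltnS leqNgt; apply/negP => /chain_en.
have [T TL Tr] := text_extension (subset_trans rk (chain_le le_ki)).
have := monM _ T (Cchain i.+1) TL (size s) (size r) e f.
rewrite -size_cat Tr -(take_initial_segment T (leq_addr (size r) _)).
rewrite -size_cat Tr.
rewrite take_size_cat // => /(_ Ms Mr (en i)); rewrite He Hf TL.
by case=> //; split; [apply: A_en | apply: chain_en].
Qed.

End Chain.
End PositiveEquivalence.

(** * Equivalence of the three conditions *)

Theorem theorem19 (W : nat -> set nat) (hW : acceptable W)
    (eta : nat -> nat -> Prop) (heta : positive_equivalence eta) :
  let P1 := exists C : set (set nat),
    [/\ eta_family eta C, Ex_learnable W eta C
      & ~ monotonically_BC_learnable W eta C] in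
  let P2 := exists C : set (set nat),
    [/\ eta_family eta C,
        class_preservingly_weakly_monotonically_Ex_learnable C
      & ~ monotonically_BC_learnable W eta C] in
  let P3 := exists A : set nat,
    [/\ eta_infinite eta A, re_set A & A <> setT] in
  (P1 <-> P2) /\ (P2 <-> P3).
Proof.
move=> P1 P2 P3; have [eqv re_eta _] := heta.
have P21 : P2 -> P1.
  move=> [C [famC learnC nmon]]; exists C; split=> //.
  by apply: class_preserving_Ex_learnable learnC.
have P13 : P1 -> P3.
  move=> [C [famC exC nmon]]; apply: contrapT => nP3; apply: nmon.
  apply: (monotonically_BC_learnable_of_infinite_setT eqv hW famC exC).
  move=> A infA reA.
  by apply: contrapT => AT; apply: nP3; exists A.
suff P32 : P3 -> P2 by tauto.
move=> [A [/(eta_infiniteP eqv)[/(eta_closedP eqv) Acl ninf] reA AT]].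
have [a NAa] : exists a, ~ A a.
  by apply/existsNP => allA; apply: AT; apply/seteqP; split.
(* Members of [s] outside [A] are equivalent to no element of [A], so only those in [A] count as
   representatives. *)
have Ainf (s : seq nat) : exists2 x, A x & forall y, y \in s -> ~ eta y x.
  apply: contrapT => nx; apply: ninf; exists [seq y <- s | `[<A y>]].
  split=> [x|x Ax].
    by rewrite mem_filter => /andP[/asboolP].
  apply: contrapT => ny; apply: nx; exists x => // y sy yx; apply: ny.
  exists y => //; rewrite mem_filter sy andbT; apply/asboolP.
  by apply: Acl Ax _; symmetry.
have [x0 Ax0 _] := Ainf [::].
have [en ren enA] := re_set_enum reA Ax0.
exists (range (chain_hyp eta A a en)); split.
- exact: chain_family.
- exists (chain_hyp eta A a en), (chain_learner eqv a Ainf enA); split.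
  + by split=> //; apply: re_chain_hyp.
  + exact: learner_chain.
  + exact: chain_learner_Ex.
  + exact: chain_learner_weakly_monotonic.
- by move=> [M [_ bcM]]; apply: chain_not_monotonic bcM.
Qed.
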